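(* Let $(\mathcal{A},\mu,\Delta,(\alpha_i)_{i=1,2})$ be a finite-dimensional totally hom-associative ternary infinitesimal bialgebra over a field $\mathcal{K}$ of characteristic zero. Then $(\mathcal{A}^*,\Delta^*,\mu^*,(\alpha_i^* )_{i=1,2})$ is a totally hom-associative ternary infinitesimal bialgebra (with ternary product $\Delta^*$, ternary coproduct $\mu^*$ and twisting maps $\alpha_1^*,\alpha_2^*$).
   Context: A totally hom-associative ternary infinitesimal bialgebra $(\mathcal{A},\mu,\Delta,(\alpha_i)_{i=1,2})$ is a vector space $\mathcal{A}$ with linear maps $\mu:\mathcal{A}^{\otimes3}\to\mathcal{A}$, $\Delta:\mathcal{A}\to\mathcal{A}^{\otimes3}$, $\alpha_1,\alpha_2:\mathcal{A}\to\mathcal{A}$ such that: (1) $(\mathcal{A},\mu,(\alpha_i))$ is a totally hom-associative ternary algebra: for all $x_1,\dots,x_5\in\mathcal{A}$, $\mu(\mu(x_1,x_2,x_3),\alpha_1(x_4),\alpha_2(x_5))=\mu(\alpha_1(x_1),\mu(x_2,x_3,x_4),\alpha_2(x_5))=\mu(\alpha_1(x_1),\alpha_2(x_2),\mu(x_3,x_4,x_5))$; (2) $(\mathcal{A},\Delta,(\alpha_i))$ is a totally hom-coassociative ternary coalgebra: $(\Delta\otimes\alpha_1\otimes\alpha_2)\circ\Delta=(\alpha_1\otimes\Delta\otimes\alpha_2)\circ\Delta=(\alpha_1\otimes\alpha_2\otimes\Delta)\circ\Delta$; (3) for all $x,y,z\in\mathcal{A}$, $$\Delta\mu(x,y,z)=(L_\mu(\alpha_1(x),\alpha_2(y))\otimes\alpha_1\otimes\alpha_2)\Delta(z)+(\alpha_1\otimes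 M_\mu(\alpha_1(x),\alpha_2(z))\otimes\alpha_2)\Delta(y)+(\alpha_1\otimes\alpha_2\otimes R_\mu(\alpha_1(y),\alpha_2(z)))\Delta(x),$$ where $L_\mu(x,y)(z)=\mu(x,y,z)$, $R_\mu(x,y)(z)=\mu(z,x,y)$, $M_\mu(x,y)(z)=\mu(x,z,y)$. Dual maps: with $\langle\xi,x\rangle=\xi(x)$ and $\langle\xi\otimes\eta\otimes\gamma,x\otimes y\otimes z\rangle=\langle\xi,x\rangle\langle\eta,y\rangle\langle\gamma,z\rangle$, put $\langle\alpha^*(f),x\rangle=\langle f,\alpha(x)\rangle$, $\langle\Delta^*(\xi,\eta,\gamma),x\rangle=\langle\xi\otimes\eta\otimes\gamma,\Delta(x)\rangle$ and $\langle\mu^*(\xi),x\otimes y\otimes z\rangle=\langle\xi,\mu(x,y,z)\rangle$. *)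

(* Defs.v *)
From HB Require Import structures.
From mathcomp Require Import all_boot ssralg vector sesquilinear.

Set Implicit Arguments.
Unset Strict Implicit.
Unset Printing Implicit Defensive.

Import GRing.Theory.
Local Open Scope ring_scope.

(* A [vectType K] is by definition finite-dimensional. *)
Definition dual (K : fieldType) (V : vectType K) : vectType K := 'Hom(V, K^o).

(* The transpose of f, i.e. <transpose f xi, x> = <xi, f x>. *)
Definition transpose (K : fieldType) (U V : vectType K) (f : 'Hom(U, V)) :
    'Hom(dual V, dual U) :=
  linfun (fun xi : dual V => (xi \o f)%VF : dual U).

(* The library has no tensor product.  For finite-dimensional U and V we take
   the usual model U (x) V = Hom(U^*, V), in which u (x) v is the map
   phi |-> phi(u) v.  The lemmas [tensor_lift_pure] and [tensor_lift_unique]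
   are its universal property. *)
Definition tensor (K : fieldType) (U V : vectType K) : vectType K :=
  'Hom(dual U, V).

Declare Scope tensor_scope.
Delimit Scope tensor_scope with T.
Notation "U ⊗ V" := (tensor U V) (at level 35, right associativity) :
  tensor_scope.
Local Open Scope tensor_scope.

Section Tensor.
Variable K : fieldType.
Implicit Types U V W X : vectType K.

Definition pure U V (u : U) (v : V) : U ⊗ V :=
  linfun (fun phi : dual U => (phi u : K) *: v).

Definition coord_form U (i : 'I_(\dim {:U})) : dual U :=
  linfun (fun u : U => coord (vbasis {:U}) i u : K^o).

(* The linear map on U (x) V with u (x) v |-> f u v, for f bilinear. *)
Definition tensor_lift U V X (f : U -> V -> X) : 'Hom(U ⊗ V, X) :=
  linfun (fun t : U ⊗ V =>
    \sum_(i < \dim {:U})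
      f (vbasis {:U})`_i ((t : 'Hom(dual U, V)) (coord_form i))).

Definition tensor_map U U' V V' (f : 'Hom(U, U')) (g : 'Hom(V, V')) :
    'Hom(U ⊗ V, U' ⊗ V') :=
  tensor_lift (fun u v => pure (f u) (g v)).

Definition tensor_assoc U V W : 'Hom((U ⊗ V) ⊗ W, U ⊗ (V ⊗ W)) :=
  tensor_lift (fun (s : U ⊗ V) (w : W) =>
    tensor_lift (fun (u : U) (v : V) => pure u (pure v w)) s).

(* U^* (x) V^* -> (U (x) V)^*, with
   <phi (x) psi, u (x) v> = <phi, u> <psi, v>. *)
Definition dual_tensor U V : 'Hom(dual U ⊗ dual V, dual (U ⊗ V)) :=
  tensor_lift (fun (phi : dual U) (psi : dual V) =>
    tensor_lift (fun (u : U) (v : V) => (phi u * psi v : K^o)) : dual (U ⊗ V)).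

End Tensor.

Arguments tensor_assoc {K} U V W.
Arguments dual_tensor {K} U V.

Notation "f '⊗f' g" := (tensor_map f g) (at level 35, right associativity) :
  tensor_scope.

Section TensorTheory.
Variable K : fieldType.
Implicit Types U V W X : vectType K.

Lemma linfunE U V (f : U -> V) : linear f -> linfun f =1 f.
Proof.
move=> fL.
pose F : {linear U -> V} := HB.pack f (GRing.isLinear.Build K U V *:%R f fL).
exact: (lfunE F).
Qed.

Lemma transposeE U V (f : 'Hom(U, V)) (xi : dual V) (x : U) :
  (transpose f xi : dual U) x = xi (f x).
Proof.
rewrite linfunE ?comp_lfunE // => a p q.
by rewrite comp_lfunDl comp_lfunZl.
Qed.

Lemma pureE U V (u : U) (v : V) (phi : dual U) :
  (pure u v : 'Hom(dual U, V)) phi = (phi u : K) *: v.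
Proof.
rewrite linfunE // => a p q.
by rewrite add_lfunE scale_lfunE scalerDl scalerA.
Qed.

Lemma coord_formE U i (u : U) : coord_form i u = coord (vbasis {:U}) i u.
Proof. by rewrite linfunE // => a p q; rewrite linearP. Qed.

Lemma pure_bilinear U V : bilinear_for *:%R *:%R (@pure K U V).
Proof.
split=> [v a u w | u a v w]; apply/lfunP=> phi;
  rewrite add_lfunE scale_lfunE !pureE.
  by rewrite linearP scalerDl scalerA.
by rewrite scalerDr !scalerA mulrC.
Qed.

Lemma tensor_liftE U V X (f : U -> V -> X) (t : U ⊗ V) :
  bilinear_for *:%R *:%R f -> tensor_lift f t =
    \sum_(i < \dim {:U})
      f (vbasis {:U})`_i ((t : 'Hom(dual U, V)) (coord_form i)).
Proof.
move=> [fl fr]; rewrite linfunE // => a p q.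
rewrite scaler_sumr -big_split /=; apply: eq_bigr => i _.
by rewrite add_lfunE scale_lfunE fr.
Qed.

Lemma tensor_lift_pure U V X (f : U -> V -> X) :
  bilinear_for *:%R *:%R f ->
  forall u v, tensor_lift f (pure u v) = f u v.
Proof.
move=> fB u v; rewrite tensor_liftE //; case: fB => fl fr.
pose F := HB.pack_for {linear U -> X} (f^~ v)
  (GRing.isLinear.Build K U X *:%R (f^~ v) (fl v)).
rewrite [in RHS](coord_vbasis (memvf u)) -[RHS]/(F _) linear_sum.
apply: eq_bigr => i _; rewrite pureE coord_formE linearZ /=.
pose G := HB.pack_for {linear V -> X} (f (vbasis {:U})`_i)
  (GRing.isLinear.Build K V X *:%R _ (fr (vbasis {:U})`_i)).
by rewrite -[LHS]/(G _) linearZ.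
Qed.

Lemma tensor_pureE U V (t : U ⊗ V) :
  t = \sum_(i < \dim {:U})
        pure (vbasis {:U})`_i ((t : 'Hom(dual U, V)) (coord_form i)).
Proof.
apply/lfunP=> phi; rewrite sum_lfunE.
under eq_bigr do rewrite pureE.
have -> : phi = \sum_(i < \dim {:U})
      (phi (vbasis {:U})`_i : K) *: coord_form i.
  apply/lfunP=> u; rewrite sum_lfunE [in LHS](coord_vbasis (memvf u)) linear_sum.
  by apply: eq_bigr => i _; rewrite scale_lfunE coord_formE linearZ /=; exact: mulrC.
rewrite linear_sum; apply: eq_bigr => i _; rewrite linearZ /=; congr (_ *: _).
rewrite sum_lfunE (bigD1 i) //= big1 ?addr0 => [|j jNi].
  rewrite scale_lfunE coord_formE coord_free ?eqxx ?mulr1 //.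
    by rewrite -[LHS]mulr1.
  exact: basis_free (vbasisP _).
rewrite scale_lfunE coord_formE coord_free; last exact: basis_free (vbasisP _).
by rewrite eq_sym (negbTE jNi) scaler0.
Qed.

Lemma tensor_lift_unique U V X (g h : 'Hom(U ⊗ V, X)) :
  (forall u v, g (pure u v) = h (pure u v)) -> g = h.
Proof.
move=> gh; apply/lfunP=> t; rewrite (tensor_pureE t) !linear_sum.
by apply: eq_bigr => i _; apply: gh.
Qed.

Lemma pureDl U V u u' (v : V) : pure (u + u' : U) v = pure u v + pure u' v.
Proof. by have := (pure_bilinear U V).1 v 1 u u'; rewrite /= !scale1r. Qed.

Lemma pure0l U V (v : V) : pure (0 : U) v = 0.
Proof. by apply: (addrI (pure 0 v)); rewrite -pureDl !addr0. Qed.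

Lemma pure_suml U V n (F : 'I_n -> U) (v : V) :
  pure (\sum_i F i) v = \sum_i pure (F i) v.
Proof. by elim/big_rec2: _ => [|i x y _ <-]; rewrite ?pure0l ?pureDl. Qed.

Lemma tensor_map_pure U U' V V' (f : 'Hom(U, U')) (g : 'Hom(V, V')) u v :
  (f ⊗f g) (pure u v) = pure (f u) (g v).
Proof.
rewrite tensor_lift_pure //; split=> [w a p q | w a p q]; rewrite linearP.
  exact: (pure_bilinear _ _).1.
exact: (pure_bilinear _ _).2.
Qed.

Lemma tensor_assoc_pure U V W (u : U) (v : V) (w : W) :
  tensor_assoc U V W (pure (pure u v) w) = pure u (pure v w).
Proof.
have B (w' : W) : bilinear_for *:%R *:%R
    (fun (u : U) (v : V) => pure u (pure v w')).
  split=> [q a x y | q a x y]; first exact: (pure_bilinear _ _).1.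
  by rewrite (pure_bilinear _ _).1 (pure_bilinear _ _).2.
rewrite tensor_lift_pure ?tensor_lift_pure //.
split=> [w' a x y | s a x y]; first by rewrite linearP.
rewrite /= -scale_lfunE -add_lfunE; congr (fun_of_lfun _ s).
apply: tensor_lift_unique => u' v'; rewrite add_lfunE scale_lfunE.
by rewrite !tensor_lift_pure // !(pure_bilinear _ _).2.
Qed.

Lemma dual_tensor_pure U V (phi : dual U) (psi : dual V) (u : U) (v : V) :
  (dual_tensor U V (pure phi psi) : dual (U ⊗ V)) (pure u v) =
    (phi u : K) * psi v.
Proof.
have B (p : dual U) (q : dual V) : bilinear_for *:%R *:%R
    (fun (u : U) (v : V) => ((p u : K) * q v : K^o)).
  split=> [w a x y | w a x y] /=; rewrite linearP /=.
    by rewrite mulrDl; congr (_ + _); exact/esym/mulrA.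
  by rewrite mulrDr; congr (_ + _); exact: mulrCA.
rewrite tensor_lift_pure ?tensor_lift_pure //.
split=> [q a x y | p a x y]; apply: tensor_lift_unique => u' v';
  rewrite add_lfunE scale_lfunE !tensor_lift_pure // add_lfunE scale_lfunE.
  by rewrite mulrDl; congr (_ + _); exact/esym/mulrA.
by rewrite mulrDr; congr (_ + _); exact: mulrCA.
Qed.

Lemma dual_tensor_bij U V : bijective (dual_tensor U V).
Proof.
pose h (g : dual (U ⊗ V)) : dual U ⊗ dual V :=
  \sum_(i < \dim {:U}) pure (coord_form i)
    (linfun (fun v : V => g (pure (vbasis {:U})`_i v)) : dual V).
have gL (g : dual (U ⊗ V)) (u : U) : linear (fun v => g (pure u v) : K^o).
  by move=> a x y; rewrite (pure_bilinear _ _).2 linearP.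
have hL : linear h.
  move=> a x y; rewrite /h scaler_sumr -big_split /=; apply: eq_bigr => i _.
  rewrite -(pure_bilinear _ _).2; congr pure; apply/lfunP=> v.
  by rewrite add_lfunE scale_lfunE !(linfunE (gL _ _)) add_lfunE scale_lfunE.
exists h => [t | g].
  rewrite -[LHS](linfunE hL) -comp_lfunE -[RHS](id_lfunE t).
  congr (fun_of_lfun _ t); apply: tensor_lift_unique => phi psi.
  rewrite id_lfunE comp_lfunE linfunE //.
  have phiE : phi = \sum_(i < \dim {:U})
      (phi (vbasis {:U})`_i : K) *: coord_form i.
    apply/lfunP=> u.
    rewrite sum_lfunE [in LHS](coord_vbasis (memvf u)) linear_sum.
    apply: eq_bigr => i _; rewrite scale_lfunE coord_formE linearZ /=.
    exact: mulrC.
  rewrite [in RHS]phiE pure_suml; apply: eq_bigr => i _.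
  apply/lfunP=> c; rewrite !pureE.
  rewrite [in RHS]linearZ /= -[X in _ = X *: _]/(_ * _) mulrC -scalerA.
  congr (_ *: _).
  by apply/lfunP=> v; rewrite scale_lfunE linfunE // dual_tensor_pure.
apply: tensor_lift_unique => u v; rewrite linear_sum sum_lfunE.
rewrite [in RHS](coord_vbasis (memvf u)) pure_suml linear_sum.
apply: eq_bigr => i _; rewrite dual_tensor_pure coord_formE (linfunE (gL _ _)).
have := (pure_bilinear U V).1 v (coord (vbasis {:U}) i u) (vbasis {:U})`_i 0.
by rewrite pure0l !addr0 => ->; rewrite linearZ.
Qed.
End TensorTheory.

(* Triple tensor products are nested to the right: A ⊗ A ⊗ A is A ⊗ (A ⊗ A). *)
Section Ternary.
Variables (K : fieldType) (A : vectType K).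

Definition pure3 (x y z : A) : A ⊗ A ⊗ A := pure x (pure y z).

Variables (mu : 'Hom(A ⊗ A ⊗ A, A)) (Delta : 'Hom(A, A ⊗ A ⊗ A)).
Variables (alpha1 alpha2 : 'Hom(A, A)).

Definition ternary (x y z : A) : A := mu (pure3 x y z).

Definition L_op (x y : A) : 'Hom(A, A) := linfun (fun z => ternary x y z).
Definition R_op (x y : A) : 'Hom(A, A) := linfun (fun z => ternary z x y).
Definition M_op (x y : A) : 'Hom(A, A) := linfun (fun z => ternary x z y).

(* The canonical isomorphism (x ⊗ y ⊗ z) ⊗ w |-> x ⊗ y ⊗ z ⊗ w. *)
Definition tensor_flatten (W : vectType K) :
    'Hom((A ⊗ A ⊗ A) ⊗ W, A ⊗ A ⊗ A ⊗ W) :=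
  ((\1 ⊗f tensor_assoc A A W) \o tensor_assoc A (A ⊗ A) W)%VF.

(* The maps Delta ⊗ alpha1 ⊗ alpha2, alpha1 ⊗ Delta ⊗ alpha2 and
   alpha1 ⊗ alpha2 ⊗ Delta, all with values in A ⊗ A ⊗ A ⊗ A ⊗ A. *)
Definition Delta_left : 'Hom(A ⊗ A ⊗ A, A ⊗ A ⊗ A ⊗ A ⊗ A) :=
  (tensor_flatten (A ⊗ A) \o (Delta ⊗f alpha1 ⊗f alpha2))%VF.
Definition Delta_mid : 'Hom(A ⊗ A ⊗ A, A ⊗ A ⊗ A ⊗ A ⊗ A) :=
  ((\1 ⊗f tensor_flatten A) \o (alpha1 ⊗f Delta ⊗f alpha2))%VF.
Definition Delta_right : 'Hom(A ⊗ A ⊗ A, A ⊗ A ⊗ A ⊗ A ⊗ A) :=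
  alpha1 ⊗f alpha2 ⊗f Delta.

Record is_hom_associative : Prop := {
  hom_assoc_lm : forall x1 x2 x3 x4 x5 : A,
    ternary (ternary x1 x2 x3) (alpha1 x4) (alpha2 x5) =
    ternary (alpha1 x1) (ternary x2 x3 x4) (alpha2 x5);
  hom_assoc_mr : forall x1 x2 x3 x4 x5 : A,
    ternary (alpha1 x1) (ternary x2 x3 x4) (alpha2 x5) =
    ternary (alpha1 x1) (alpha2 x2) (ternary x3 x4 x5) }.

Record is_hom_coassociative : Prop := {
  hom_coassoc_lm : (Delta_left \o Delta = Delta_mid \o Delta)%VF;
  hom_coassoc_mr : (Delta_mid \o Delta = Delta_right \o Delta)%VF }.

Record is_hom_infinitesimal_bialgebra : Prop := {
  bialg_assoc : is_hom_associative;
  bialg_coassoc : is_hom_coassociative;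
  bialg_compat : forall x y z : A,
    Delta (ternary x y z) =
      (L_op (alpha1 x) (alpha2 y) ⊗f alpha1 ⊗f alpha2) (Delta z)
    + (alpha1 ⊗f M_op (alpha1 x) (alpha2 z) ⊗f alpha2) (Delta y)
    + (alpha1 ⊗f alpha2 ⊗f R_op (alpha1 y) (alpha2 z)) (Delta x) }.

Lemma L_opE x y z : L_op x y z = ternary x y z.
Proof.
rewrite linfunE // => a p q.
by rewrite /ternary /pure3 !(pure_bilinear _ _).2 linearP.
Qed.

Lemma R_opE x y z : R_op x y z = ternary z x y.
Proof.
rewrite linfunE // => a p q.
by rewrite /ternary /pure3 (pure_bilinear _ _).1 linearP.
Qed.

Lemma M_opE x y z : M_op x y z = ternary x z y.
Proof.
rewrite linfunE // => a p q.
by rewrite /ternary /pure3 (pure_bilinear _ _).1 (pure_bilinear _ _).2 linearP.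
Qed.

Lemma tensor_flatten_pure (W : vectType K) x y z (w : W) :
  tensor_flatten W (pure (pure3 x y z) w) = pure x (pure y (pure z w)).
Proof.
by rewrite comp_lfunE tensor_assoc_pure tensor_map_pure tensor_assoc_pure id_lfunE.
Qed.

End Ternary.

Section Duality.
Variables (K : fieldType) (A : vectType K).

(* xi ⊗ eta ⊗ gamma |-> <xi ⊗ eta ⊗ gamma, ->; an isomorphism because A is
   finite-dimensional. *)
Definition dual_tensor3 :
    'Hom(dual A ⊗ dual A ⊗ dual A, dual (A ⊗ A ⊗ A)) :=
  (dual_tensor A (A ⊗ A) \o (\1 ⊗f dual_tensor A A))%VF.

(* [dual_product_pair] and [dual_coproduct_pair] are the defining equations. *)
Definition dual_product (Delta : 'Hom(A, A ⊗ A ⊗ A)) :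
    'Hom(dual A ⊗ dual A ⊗ dual A, dual A) :=
  (transpose Delta \o dual_tensor3)%VF.

Definition dual_coproduct (mu : 'Hom(A ⊗ A ⊗ A, A)) :
    'Hom(dual A, dual A ⊗ dual A ⊗ dual A) :=
  (dual_tensor3^-1 \o transpose mu)%VF.

Lemma dual_tensor3_pure (xi eta gamma : dual A) (x y z : A) :
  (dual_tensor3 (pure3 xi eta gamma) : dual (A ⊗ A ⊗ A)) (pure3 x y z) =
    (xi x : K) * ((eta y : K) * gamma z).
Proof.
by rewrite comp_lfunE tensor_map_pure id_lfunE !dual_tensor_pure.
Qed.

Lemma dual_tensor3_bij : bijective dual_tensor3.
Proof.
have [h hK Kh] := dual_tensor_bij A A.
have ker0 : lker (dual_tensor A A) == 0%VS by apply/lker0P; apply: can_inj hK.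
have KV : (dual_tensor A A \o (dual_tensor A A)^-1 = \1)%VF.
  apply/lfunP=> g; rewrite comp_lfunE id_lfunE limg_lfunVK //.
  by rewrite -(Kh g) memv_img ?memvf.
apply: (@eq_bij _ _ (dual_tensor A (A ⊗ A) \o (\1 ⊗f dual_tensor A A)%T)).
  apply: bij_comp (dual_tensor_bij _ _) _.
  exists (\1 ⊗f (dual_tensor A A)^-1)%VF => t;
    rewrite -comp_lfunE -[RHS]id_lfunE; congr (fun_of_lfun _ t);
    apply: tensor_lift_unique => u v;
    rewrite comp_lfunE !tensor_map_pure !id_lfunE.
  by rewrite lker0_lfunK.
  by rewrite -comp_lfunE KV id_lfunE.
by move=> t; rewrite /= comp_lfunE.
Qed.

Lemma dual_product_pair Delta (xi eta gamma : dual A) (x : A) :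
  (ternary (dual_product Delta) xi eta gamma : dual A) x =
    (dual_tensor3 (pure3 xi eta gamma) : dual (A ⊗ A ⊗ A)) (Delta x).
Proof. by rewrite /ternary comp_lfunE transposeE. Qed.

Lemma dual_coproduct_pair mu (xi : dual A) (x y z : A) :
  (dual_tensor3 (dual_coproduct mu xi) : dual (A ⊗ A ⊗ A)) (pure3 x y z) =
    xi (ternary mu x y z).
Proof.
rewrite [dual_coproduct _ _]comp_lfunE limg_lfunVK ?transposeE //.
have [h _ Kh] := dual_tensor3_bij.
by rewrite -(Kh (transpose mu xi)) memv_img ?memvf.
Qed.
End Duality.

(* Main.v *)
Require Import Defs.
From HB Require Import structures.
From mathcomp Require Import all_boot ssralg vector.

(** Every axiom of the structure is an identity between multilinear
    expressions, and the axioms as a whole are invariant under transposition.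
    Pairing five covectors with the coassociativity identity for [Delta] gives
    the associativity identity for [Delta^*]; pairing a covector with the
    associativity identity for [mu], evaluated on five vectors, gives
    coassociativity of [mu^*], because the pairing of the fifth tensor powers
    of [A^*] and [A] is nondegenerate in finite dimension.

    The compatibility condition is self-dual up to a permutation of its terms.
    Write Delta(x) = x1 (x) x2 (x) x3.  The [L]-term for [A^*], paired with
    x (x) y (x) z, is
      <xi, alpha1 x1> <eta, alpha2 x2> <gamma, mu(x3, alpha1 y, alpha2 z)>,
    which is the [R]-term for [A] paired with xi (x) eta (x) gamma.  In the
    same way the [R]-term becomes the [L]-term, and the [M]-term is kept.

    Covectors are applied to a tensor that is not pure, such as [Delta x], and
    the tensor [mu^* xi] is not pure either.  The lemmas therefore treat an
    arbitrary tensor in the place of [Delta x] or [mu^* xi]: both sides are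
    linear in it, so that pure tensors suffice for the proof. *)

Set Implicit Arguments.
Unset Strict Implicit.
Unset Printing Implicit Defensive.

Import GRing.Theory.
Local Open Scope ring_scope.
Local Open Scope tensor_scope.

(** * Linear maps on iterated tensor products *)

Section Extensionality.
Variable K : fieldType.
Implicit Types U V W X : vectType K.

Lemma pure_linear_l U V (v : V) : linear (fun u : U => pure u v).
Proof. exact: (pure_bilinear U V).1. Qed.

Lemma pure_linear_r U V (u : U) : linear (fun v : V => pure u v).
Proof. exact: (pure_bilinear U V).2. Qed.

(** Currying: a linear map on U (x) V that is known on u (x) - for each u is
    known.  Iterating this reaches all the right-nested tensor products. *)
Lemma tensor_curry_ext U V X (g h : 'Hom(U ⊗ V, X)) :
  (forall u, g \o linfun (fun v => pure u v) =
             h \o linfun (fun v => pure u v))%VF -> g = h.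
Proof.
move=> gh; apply: tensor_lift_unique => u v.
have := congr1 (fun k : 'Hom(V, X) => k v) (gh u).
by rewrite !comp_lfunE !(linfunE (pure_linear_r u)).
Qed.

Lemma tensor3_ext U V W X (g h : 'Hom(U ⊗ V ⊗ W, X)) :
  (forall u v w, g (pure u (pure v w)) = h (pure u (pure v w))) -> g = h.
Proof.
move=> gh; apply: tensor_curry_ext => u; apply: tensor_lift_unique => v w.
by rewrite !comp_lfunE !(linfunE (pure_linear_r u)).
Qed.

Lemma tensor5_ext U1 U2 U3 U4 U5 X (g h : 'Hom(U1 ⊗ U2 ⊗ U3 ⊗ U4 ⊗ U5, X)) :
  (forall u1 u2 u3 u4 u5,
     g (pure u1 (pure u2 (pure u3 (pure u4 u5)))) =
     h (pure u1 (pure u2 (pure u3 (pure u4 u5))))) -> g = h.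
Proof.
move=> gh; apply: tensor_curry_ext => u1; apply: tensor_curry_ext => u2.
apply: tensor3_ext => u3 u4 u5.
by rewrite !comp_lfunE !(linfunE (pure_linear_r _)).
Qed.

(** Two families of forms, evaluated at fixed vectors, may be compared on pure
    tensors only; the forms may live on different spaces, as for a form on the
    fifth tensor power and one on the third. *)
Lemma tensor3_form_ext U V W X Y (F : 'Hom(U ⊗ V ⊗ W, dual X))
    (G : 'Hom(U ⊗ V ⊗ W, dual Y)) (x : X) (y : Y) :
  (forall u v w, (F (pure u (pure v w)) : dual X) x =
                 (G (pure u (pure v w)) : dual Y) y) ->
  forall t, (F t : dual X) x = (G t : dual Y) y.
Proof.
have evL (Z : vectType K) (z : Z) : linear (fun phi : dual Z => phi z).
  by move=> a phi psi; rewrite add_lfunE scale_lfunE.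
move=> FG t; rewrite -[LHS](linfunE (evL X x)) -[RHS](linfunE (evL Y y)).
rewrite -!comp_lfunE; congr (fun_of_lfun _ t); apply: tensor3_ext => u v w.
by rewrite !comp_lfunE (linfunE (evL X x)) (linfunE (evL Y y)).
Qed.

End Extensionality.

Section Pairing.
Variables (K : fieldType) (A : vectType K).
Implicit Types (x y z : A) (xi eta gamma : dual A).

Lemma dual_tensor3_transpose (f g h : 'Hom(A, A)) xi eta gamma t :
  (dual_tensor3 A (pure3 (transpose f xi) (transpose g eta)
     (transpose h gamma)) : dual (A ⊗ A ⊗ A)) t =
  (dual_tensor3 A (pure3 xi eta gamma) : dual (A ⊗ A ⊗ A))
    ((f ⊗f g ⊗f h) t).
Proof.
rewrite -comp_lfunE; congr (fun_of_lfun _ t); apply: tensor3_ext => x y z.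
rewrite [RHS]comp_lfunE !tensor_map_pure [LHS]dual_tensor3_pure !transposeE.
exact/esym/dual_tensor3_pure.
Qed.

(** * The pairing of fifth tensor powers *)

Definition dual_tensor5 :
    'Hom(dual A ⊗ dual A ⊗ dual A ⊗ dual A ⊗ dual A,
         dual (A ⊗ A ⊗ A ⊗ A ⊗ A)) :=
  (dual_tensor A (A ⊗ A ⊗ A ⊗ A) \o
    (\1 ⊗f (dual_tensor A (A ⊗ A ⊗ A) \o (\1 ⊗f dual_tensor3 A))))%VF.

Definition pure5 (B : vectType K) (x1 x2 x3 x4 x5 : B) : B ⊗ B ⊗ B ⊗ B ⊗ B :=
  pure x1 (pure x2 (pure3 x3 x4 x5)).

Lemma dual_tensor5_pure (xi1 xi2 xi3 xi4 xi5 : dual A) (x1 x2 x3 x4 x5 : A) :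
  (dual_tensor5 (pure5 xi1 xi2 xi3 xi4 xi5) : dual (A ⊗ A ⊗ A ⊗ A ⊗ A))
    (pure5 x1 x2 x3 x4 x5) =
  (xi1 x1 : K) * ((xi2 x2 : K) * ((xi3 x3 : K) * ((xi4 x4 : K) * xi5 x5))).
Proof.
rewrite comp_lfunE tensor_map_pure id_lfunE comp_lfunE tensor_map_pure.
by rewrite id_lfunE !dual_tensor_pure dual_tensor3_pure.
Qed.

Lemma tensor_map_id_inj (U V W : vectType K) (f : 'Hom(V, W)) :
  injective f -> injective (\1 ⊗f f : 'Hom(U ⊗ V, U ⊗ W)).
Proof.
move=> /lker0P f0; apply: (@can_inj _ _ _ (\1 ⊗f f^-1)%VF) => t.
rewrite -comp_lfunE -[RHS]id_lfunE; congr (fun_of_lfun _ t).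
apply: tensor_lift_unique => u v.
by rewrite comp_lfunE !tensor_map_pure !id_lfunE lker0_lfunK.
Qed.

(** The pairing separates the tensors of covectors: it is built from
    isomorphisms, since [A] is finite-dimensional, and f (x) g is injective
    when f is the identity and g is injective. *)
Lemma dual_tensor5_inj : injective dual_tensor5.
Proof.
move=> s t; rewrite !comp_lfunE => /(bij_inj (dual_tensor_bij _ _)).
apply: tensor_map_id_inj => {}s {}t.
rewrite !comp_lfunE => /(bij_inj (dual_tensor_bij _ _)).
exact/tensor_map_id_inj/bij_inj/dual_tensor3_bij.
Qed.

(** Both sides are bilinear in (s, t).  Here [i] and [j] insert a triple tensor
    into larger tensors with fixed remaining factors, and [c] is the pairing of
    those factors. *)
Lemma pairing3_ext (U V : vectType K) (b : 'Hom(U, dual V))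
    (i : dual A ⊗ dual A ⊗ dual A -> U) (j : A ⊗ A ⊗ A -> V) (c : K) :
  linear i -> linear j ->
  (forall xi eta gamma x y z,
     (b (i (pure3 xi eta gamma)) : dual V) (j (pure3 x y z)) =
     (xi x : K) * ((eta y : K) * gamma z) * c) ->
  forall s t, (b (i s) : dual V) (j t) =
    ((dual_tensor3 A s : dual (A ⊗ A ⊗ A)) t : K) * c.
Proof.
move=> iL jL bE s t.
have E : (transpose (linfun j) \o (b \o linfun i) = c *: dual_tensor3 A)%VF.
  apply: tensor3_ext => xi eta gamma; apply: tensor3_ext => x y z.
  rewrite comp_lfunE transposeE comp_lfunE (linfunE iL) (linfunE jL) bE.
  rewrite !scale_lfunE dual_tensor3_pure; exact: mulrC.
have := congr1 (fun F : 'Hom(_, _) => (F s : dual (A ⊗ A ⊗ A)) t) E.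
rewrite comp_lfunE transposeE comp_lfunE (linfunE iL) (linfunE jL) => ->.
rewrite !scale_lfunE; exact: mulrC.
Qed.

(** The next three lemmas allow arbitrary tensors on both sides, so each serves
    the two directions of the duality: [t] becomes [Delta x] for the dual
    product, [s] becomes [mu^* xi] for the dual coproduct. *)
Lemma dual_tensor5_left s eta gamma t y z :
  (dual_tensor5 (tensor_flatten _ _ (pure s (pure eta gamma))) :
     dual (A ⊗ A ⊗ A ⊗ A ⊗ A)) (tensor_flatten _ _ (pure t (pure y z))) =
  ((dual_tensor3 A s : dual (A ⊗ A ⊗ A)) t : K) * ((eta y : K) * gamma z).
Proof.
apply: (pairing3_ext (i := fun s => tensor_flatten _ _ (pure s _))
  (j := fun t => tensor_flatten _ _ (pure t _))) => [a u v | a u v | ].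
- by rewrite pure_linear_l linearP.
- by rewrite pure_linear_l linearP.
move=> xi1 xi2 xi3 x1 x2 x3; rewrite !tensor_flatten_pure.
by rewrite [LHS]dual_tensor5_pure !mulrA.
Qed.

Lemma dual_tensor5_mid xi s gamma x t z :
  (dual_tensor5 (pure xi (tensor_flatten _ _ (pure s gamma))) :
     dual (A ⊗ A ⊗ A ⊗ A ⊗ A)) (pure x (tensor_flatten _ _ (pure t z))) =
  ((dual_tensor3 A s : dual (A ⊗ A ⊗ A)) t : K) * ((xi x : K) * gamma z).
Proof.
apply: (pairing3_ext (i := fun s => pure _ (tensor_flatten _ _ (pure s _)))
  (j := fun t => pure _ (tensor_flatten _ _ (pure t _)))) => [a u v | a u v | ].
- by rewrite pure_linear_l linearP pure_linear_r.
- by rewrite pure_linear_l linearP pure_linear_r.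
move=> xi1 xi2 xi3 x1 x2 x3; rewrite !tensor_flatten_pure.
by rewrite [LHS]dual_tensor5_pure [RHS]mulrCA !mulrA.
Qed.

Lemma dual_tensor5_right xi eta s x y t :
  (dual_tensor5 (pure xi (pure eta s)) : dual (A ⊗ A ⊗ A ⊗ A ⊗ A))
    (pure x (pure y t)) =
  ((dual_tensor3 A s : dual (A ⊗ A ⊗ A)) t : K) * ((xi x : K) * eta y).
Proof.
apply: (pairing3_ext (i := fun s => pure _ (pure _ s))
  (j := fun t => pure _ (pure _ t))) => [a u v | a u v | ].
- by rewrite !pure_linear_r.
- by rewrite !pure_linear_r.
move=> xi1 xi2 xi3 x1 x2 x3.
by rewrite [LHS]dual_tensor5_pure [RHS]mulrC !mulrA.
Qed.

(** * Duality between associativity and coassociativity *)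

Variables (mu : 'Hom(A ⊗ A ⊗ A, A)) (Delta : 'Hom(A, A ⊗ A ⊗ A)).
Variables (alpha1 alpha2 : 'Hom(A, A)).

Local Notation "f ^*" := (transpose f).
Local Notation Delta_s := (dual_product Delta).
Local Notation mu_s := (dual_coproduct mu).

(** The three bracketings of [Delta^*] are the transposes of the three iterated
    coproducts.  The tensor [t] stands for [Delta x], which is not pure. *)
Lemma dual_product_left xi1 xi2 xi3 xi4 xi5 t :
  (dual_tensor3 A (pure3 (ternary Delta_s xi1 xi2 xi3)
     (alpha1^* xi4) (alpha2^* xi5)) : dual (A ⊗ A ⊗ A)) t =
  (dual_tensor5 (pure5 xi1 xi2 xi3 xi4 xi5) : dual (A ⊗ A ⊗ A ⊗ A ⊗ A))
    (Delta_left Delta alpha1 alpha2 t).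
Proof.
rewrite -[RHS]comp_lfunE; congr (fun_of_lfun _ t).
apply: tensor3_ext => x y z.
rewrite [RHS]comp_lfunE [Delta_left _ _ _ _]comp_lfunE.
rewrite !tensor_map_pure [LHS]dual_tensor3_pure dual_product_pair !transposeE.
rewrite -[pure5 _ _ _ _ _](tensor_flatten_pure xi1 xi2 xi3 (pure xi4 xi5)).
exact/esym/dual_tensor5_left.
Qed.

Lemma dual_product_mid xi1 xi2 xi3 xi4 xi5 t :
  (dual_tensor3 A (pure3 (alpha1^* xi1) (ternary Delta_s xi2 xi3 xi4)
     (alpha2^* xi5)) : dual (A ⊗ A ⊗ A)) t =
  (dual_tensor5 (pure5 xi1 xi2 xi3 xi4 xi5) : dual (A ⊗ A ⊗ A ⊗ A ⊗ A))
    (Delta_mid Delta alpha1 alpha2 t).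
Proof.
rewrite -[RHS]comp_lfunE; congr (fun_of_lfun _ t).
apply: tensor3_ext => x y z.
rewrite [RHS]comp_lfunE [Delta_mid _ _ _ _]comp_lfunE.
rewrite !tensor_map_pure id_lfunE [LHS]dual_tensor3_pure dual_product_pair.
rewrite !transposeE /pure5 -(tensor_flatten_pure xi2 xi3 xi4 xi5).
by rewrite dual_tensor5_mid mulrCA.
Qed.

Lemma dual_product_right xi1 xi2 xi3 xi4 xi5 t :
  (dual_tensor3 A (pure3 (alpha1^* xi1) (alpha2^* xi2)
     (ternary Delta_s xi3 xi4 xi5)) : dual (A ⊗ A ⊗ A)) t =
  (dual_tensor5 (pure5 xi1 xi2 xi3 xi4 xi5) : dual (A ⊗ A ⊗ A ⊗ A ⊗ A))
    (Delta_right Delta alpha1 alpha2 t).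
Proof.
rewrite -[RHS]comp_lfunE; congr (fun_of_lfun _ t).
apply: tensor3_ext => x y z; rewrite [RHS]comp_lfunE /Delta_right.
rewrite !tensor_map_pure [LHS]dual_tensor3_pure dual_product_pair !transposeE.
by rewrite dual_tensor5_right [RHS]mulrC mulrA.
Qed.

Lemma dual_product_hom_associative :
  is_hom_coassociative Delta alpha1 alpha2 ->
  is_hom_associative Delta_s (alpha1^*) (alpha2^*).
Proof.
move=> [lm mr].
split=> xi1 xi2 xi3 xi4 xi5; apply/lfunP=> x; rewrite !dual_product_pair.
  rewrite dual_product_left dual_product_mid -!(comp_lfunE _ Delta).
  by rewrite lm.
rewrite dual_product_mid dual_product_right -!(comp_lfunE _ Delta).
by rewrite mr.
Qed.

(** Conversely, the iterated coproducts of [mu^*] are the transposes of the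
    bracketings of [mu], with [s] in the place of [mu^* xi]. *)
Lemma dual_coproduct_left s x1 x2 x3 x4 x5 :
  (dual_tensor5 (Delta_left mu_s (alpha1^*) (alpha2^*) s) :
     dual (A ⊗ A ⊗ A ⊗ A ⊗ A)) (pure5 x1 x2 x3 x4 x5) =
  (dual_tensor3 A s : dual (A ⊗ A ⊗ A))
    (pure3 (ternary mu x1 x2 x3) (alpha1 x4) (alpha2 x5)).
Proof.
rewrite -[dual_tensor5 _]comp_lfunE; move: s; apply: tensor3_form_ext.
move=> xi eta gamma.
rewrite [RHS]dual_tensor3_pure [X in fun_of_lfun X]comp_lfunE.
rewrite [Delta_left _ _ _ _]comp_lfunE !tensor_map_pure.
rewrite -[pure5 _ _ _ _ _](tensor_flatten_pure x1 x2 x3 (pure x4 x5)).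
by rewrite dual_tensor5_left dual_coproduct_pair !transposeE.
Qed.

Lemma dual_coproduct_mid s x1 x2 x3 x4 x5 :
  (dual_tensor5 (Delta_mid mu_s (alpha1^*) (alpha2^*) s) :
     dual (A ⊗ A ⊗ A ⊗ A ⊗ A)) (pure5 x1 x2 x3 x4 x5) =
  (dual_tensor3 A s : dual (A ⊗ A ⊗ A))
    (pure3 (alpha1 x1) (ternary mu x2 x3 x4) (alpha2 x5)).
Proof.
rewrite -[dual_tensor5 _]comp_lfunE; move: s; apply: tensor3_form_ext.
move=> xi eta gamma.
rewrite [RHS]dual_tensor3_pure [X in fun_of_lfun X]comp_lfunE.
rewrite [Delta_mid _ _ _ _]comp_lfunE !tensor_map_pure id_lfunE.
rewrite /pure5 -(tensor_flatten_pure x2 x3 x4 x5).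
by rewrite dual_tensor5_mid dual_coproduct_pair !transposeE mulrCA.
Qed.

Lemma dual_coproduct_right s x1 x2 x3 x4 x5 :
  (dual_tensor5 (Delta_right mu_s (alpha1^*) (alpha2^*) s) :
     dual (A ⊗ A ⊗ A ⊗ A ⊗ A)) (pure5 x1 x2 x3 x4 x5) =
  (dual_tensor3 A s : dual (A ⊗ A ⊗ A))
    (pure3 (alpha1 x1) (alpha2 x2) (ternary mu x3 x4 x5)).
Proof.
rewrite -[dual_tensor5 _]comp_lfunE; move: s; apply: tensor3_form_ext.
move=> xi eta gamma.
rewrite [RHS]dual_tensor3_pure [X in fun_of_lfun X]comp_lfunE.
rewrite /Delta_right !tensor_map_pure.
by rewrite dual_tensor5_right dual_coproduct_pair !transposeE mulrC -mulrA.
Qed.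

Lemma dual_coproduct_hom_coassociative :
  is_hom_associative mu alpha1 alpha2 ->
  is_hom_coassociative mu_s (alpha1^*) (alpha2^*).
Proof.
move=> [lm mr]; split; apply/lfunP=> xi;
  rewrite [LHS]comp_lfunE [RHS]comp_lfunE.
  apply: dual_tensor5_inj; apply: tensor5_ext => x1 x2 x3 x4 x5.
  rewrite dual_coproduct_left dual_coproduct_mid !dual_coproduct_pair.
  by rewrite lm.
apply: dual_tensor5_inj; apply: tensor5_ext => x1 x2 x3 x4 x5.
rewrite dual_coproduct_mid dual_coproduct_right !dual_coproduct_pair.
by rewrite mr.
Qed.

(** * Self-duality of the compatibility condition *)

(** The slot that a slice leaves open is the one on which [L_op], [M_op] or
    [R_op] acts in a term of the compatibility condition for [dual A].  Such an
    operator is any endomorphism of [dual A] in the lemmas below, so that it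
    need not be exhibited as a transpose. *)
Definition slice1 (y z : A) : 'Hom(dual A ⊗ dual A ⊗ dual A, dual A) :=
  (transpose (linfun (fun x => pure3 x y z)) \o dual_tensor3 A)%VF.
Definition slice2 (x z : A) : 'Hom(dual A ⊗ dual A ⊗ dual A, dual A) :=
  (transpose (linfun (fun y => pure3 x y z)) \o dual_tensor3 A)%VF.
Definition slice3 (x y : A) : 'Hom(dual A ⊗ dual A ⊗ dual A, dual A) :=
  (transpose (linfun (fun z => pure3 x y z)) \o dual_tensor3 A)%VF.

Lemma slice1E s x y z : (slice1 y z s : dual A) x =
  (dual_tensor3 A s : dual (A ⊗ A ⊗ A)) (pure3 x y z).
Proof. by rewrite comp_lfunE transposeE (linfunE (pure_linear_l _)). Qed.

Lemma slice2E s x y z : (slice2 x z s : dual A) y =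
  (dual_tensor3 A s : dual (A ⊗ A ⊗ A)) (pure3 x y z).
Proof.
rewrite comp_lfunE transposeE linfunE // => a u v.
by rewrite /pure3 pure_linear_l pure_linear_r.
Qed.

Lemma slice3E s x y z : (slice3 x y s : dual A) z =
  (dual_tensor3 A s : dual (A ⊗ A ⊗ A)) (pure3 x y z).
Proof.
rewrite comp_lfunE transposeE linfunE // => a u v.
by rewrite /pure3 !pure_linear_r.
Qed.

Lemma slice1_pure xi eta gamma y z :
  slice1 y z (pure3 xi eta gamma) = ((eta y : K) * gamma z) *: xi.
Proof.
by apply/lfunP=> x; rewrite slice1E dual_tensor3_pure scale_lfunE mulrC.
Qed.

Lemma slice2_pure xi eta gamma x z :
  slice2 x z (pure3 xi eta gamma) = ((xi x : K) * gamma z) *: eta.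
Proof.
apply/lfunP=> y; rewrite slice2E dual_tensor3_pure scale_lfunE mulrCA.
exact: mulrC.
Qed.

Lemma slice3_pure xi eta gamma x y :
  slice3 x y (pure3 xi eta gamma) = ((xi x : K) * eta y) *: gamma.
Proof.
by apply/lfunP=> z; rewrite slice3E dual_tensor3_pure scale_lfunE mulrA.
Qed.

(** Slicing moves the twisting maps from the covectors to the vectors and lets
    [F] act outside. *)
Lemma slice1_map (F : 'Hom(dual A, dual A)) (g h : 'Hom(A, A)) s y z :
  slice1 y z ((F ⊗f g^* ⊗f h^*) s) = F (slice1 (g y) (h z) s).
Proof.
rewrite -!comp_lfunE; congr (fun_of_lfun _ s).
apply: tensor3_ext => xi eta gamma; rewrite [LHS]comp_lfunE [RHS]comp_lfunE.
rewrite !tensor_map_pure [in LHS]slice1_pure [in RHS]slice1_pure.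
by rewrite !transposeE linearZ.
Qed.

Lemma slice2_map (F : 'Hom(dual A, dual A)) (f h : 'Hom(A, A)) s x z :
  slice2 x z ((f^* ⊗f F ⊗f h^*) s) = F (slice2 (f x) (h z) s).
Proof.
rewrite -!comp_lfunE; congr (fun_of_lfun _ s).
apply: tensor3_ext => xi eta gamma; rewrite [LHS]comp_lfunE [RHS]comp_lfunE.
rewrite !tensor_map_pure [in LHS]slice2_pure [in RHS]slice2_pure.
by rewrite !transposeE linearZ.
Qed.

Lemma slice3_map (F : 'Hom(dual A, dual A)) (f g : 'Hom(A, A)) s x y :
  slice3 x y ((f^* ⊗f g^* ⊗f F) s) = F (slice3 (f x) (g y) s).
Proof.
rewrite -!comp_lfunE; congr (fun_of_lfun _ s).
apply: tensor3_ext => xi eta gamma; rewrite [LHS]comp_lfunE [RHS]comp_lfunE.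
rewrite !tensor_map_pure [in LHS]slice3_pure [in RHS]slice3_pure.
by rewrite !transposeE linearZ.
Qed.

(** A slice of [mu^* xi] is [xi] composed with a multiplication operator; since
    filling the last two slots leaves the first one free, the first slice gives
    [R_op], and the third gives [L_op]. *)
Lemma slice1_coproduct xi y z : slice1 y z (mu_s xi) = (R_op mu y z)^* xi.
Proof.
by apply/lfunP=> x; rewrite slice1E dual_coproduct_pair transposeE R_opE.
Qed.

Lemma slice2_coproduct xi x z : slice2 x z (mu_s xi) = (M_op mu x z)^* xi.
Proof.
by apply/lfunP=> y; rewrite slice2E dual_coproduct_pair transposeE M_opE.
Qed.

Lemma slice3_coproduct xi x y : slice3 x y (mu_s xi) = (L_op mu x y)^* xi.
Proof.
by apply/lfunP=> z; rewrite slice3E dual_coproduct_pair transposeE L_opE.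
Qed.

(** The [L]-term, in which [mu^*] is applied to the last covector, becomes the
    [R]-term, in which [Delta] is applied to the first vector. *)
Lemma dual_L_term xi eta gamma x y z :
  (dual_tensor3 A ((L_op Delta_s (alpha1^* xi) (alpha2^* eta)
     ⊗f alpha1^* ⊗f alpha2^*) (mu_s gamma)) : dual (A ⊗ A ⊗ A))
    (pure3 x y z) =
  (dual_tensor3 A (pure3 xi eta gamma) : dual (A ⊗ A ⊗ A))
    ((alpha1 ⊗f alpha2 ⊗f R_op mu (alpha1 y) (alpha2 z)) (Delta x)).
Proof.
rewrite -slice1E slice1_map slice1_coproduct L_opE dual_product_pair.
exact: dual_tensor3_transpose.
Qed.

Lemma dual_M_term xi eta gamma x y z :
  (dual_tensor3 A ((alpha1^* ⊗f M_op Delta_s (alpha1^* xi) (alpha2^* gamma)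
     ⊗f alpha2^*) (mu_s eta)) : dual (A ⊗ A ⊗ A))
    (pure3 x y z) =
  (dual_tensor3 A (pure3 xi eta gamma) : dual (A ⊗ A ⊗ A))
    ((alpha1 ⊗f M_op mu (alpha1 x) (alpha2 z) ⊗f alpha2) (Delta y)).
Proof.
rewrite -slice2E slice2_map slice2_coproduct M_opE dual_product_pair.
exact: dual_tensor3_transpose.
Qed.

Lemma dual_R_term xi eta gamma x y z :
  (dual_tensor3 A ((alpha1^* ⊗f alpha2^* ⊗f
     R_op Delta_s (alpha1^* eta) (alpha2^* gamma)) (mu_s xi)) :
       dual (A ⊗ A ⊗ A))
    (pure3 x y z) =
  (dual_tensor3 A (pure3 xi eta gamma) : dual (A ⊗ A ⊗ A))
    ((L_op mu (alpha1 x) (alpha2 y) ⊗f alpha1 ⊗f alpha2) (Delta z)).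
Proof.
rewrite -slice3E slice3_map slice3_coproduct R_opE dual_product_pair.
exact: dual_tensor3_transpose.
Qed.

End Pairing.

Theorem theorem4p11 (K : fieldType) (charK0 : [pchar K] =i pred0)
    (A : vectType K) (mu : 'Hom(A ⊗ A ⊗ A, A)) (Delta : 'Hom(A, A ⊗ A ⊗ A))
    (alpha1 alpha2 : 'Hom(A, A)) :
  is_hom_infinitesimal_bialgebra mu Delta alpha1 alpha2 ->
  is_hom_infinitesimal_bialgebra
    (dual_product Delta) (dual_coproduct mu)
    (transpose alpha1) (transpose alpha2).
Proof.
move=> [assoc coassoc compat].
split=> [||xi eta gamma]; first exact: dual_product_hom_associative.
  exact: dual_coproduct_hom_coassociative.
apply: (bij_inj (dual_tensor3_bij A)); apply: tensor3_ext => x y z.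
rewrite [LHS]dual_coproduct_pair dual_product_pair compat !linearD !add_lfunE.
rewrite [X in _ = X + _ + _]dual_L_term [X in _ = _ + X + _]dual_M_term.
rewrite [X in _ = _ + X]dual_R_term.
(* The [L]- and [R]-terms have changed places. *)
by rewrite addrC [in LHS]addrCA addrC.
Qed.
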